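(* Let $\mathcal{H}$ be a complex Hilbert space (not necessarily separable) with $\dim_{\mathbb{C}}\mathcal{H}\ge 2$. Let $S \subset \mathbb{CP}(\mathcal{H})$ be a non-empty projective subspace and let $x \in \mathbb{CP}(\mathcal{H})$. Then there exists a point $y \in S$ such that $d(x,S) = d(x,y)$, and this number is equal to the projective angle between $x$ and $y$. Moreover, exactly one of the following two cases occurs. (1) If $x \notin S^{\perp}$, then the point $y\in S$ with $d(x,S)=d(x,y)$ is unique, and $y = \pi_{3}(E\psi)$, where $E = \pi'^{-1}(S)$, for any $\psi \in \mathbb{S}(\mathcal{H})$ satisfying $\pi_{2}(\psi) = x$. Moreover, $0 \le d(x,y) < \pi/2$. (In this case the projection of $x$ on $S$ is defined to be ${\rm Pj}(x \downarrow S) := y$.) (2) If $x \in S^{\perp}$, then $d(x,S) = d(x,y) = \pi/2$ for all $y \in S$. In this case the point $y\in S$ with $d(x,S)=d(x,y)$ is unique if and only if $\dim S = 0$, that is, $S$ is a single point. (In this case the projection of $x$ on $S$ is defined to be ${\rm Pj}(x \downarrow S) := S$.)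
   Context: The Hermitian inner product $\langle\cdot,\cdot\rangle$ on $\mathcal{H}$ is conjugate linear in the first entry and linear in the second; $\|\cdot\|$ is its norm. Write $V^{\rm x} = V\setminus\{0\}$ for a vector space $V$, $\mathbb{S}(\mathcal{H}) = \{\psi\in\mathcal{H} : \|\psi\|=1\}$, and $\mathbb{CP}(\mathcal{H}) = \mathcal{H}^{\rm x}/\mathbb{C}^{\rm x} = \mathbb{S}(\mathcal{H})/S^1$, where $S^1$ is the group of unit complex numbers. The quotient maps are $\pi_1:\mathcal{H}^{\rm x}\to\mathbb{S}(\mathcal{H})$, $\pi_1(\psi)=\psi/\|\psi\|$; $\pi_2:\mathbb{S}(\mathcal{H})\to\mathbb{CP}(\mathcal{H})$; and $\pi_3=\pi_2\circ\pi_1:\mathcal{H}^{\rm x}\to\mathbb{CP}(\mathcal{H})$. Absolute inner product: for $x,y\in\mathbb{CP}(\mathcal{H})$, $|\langle x,y\rangle| := |\langle\psi,\phi\rangle|\in[0,1]$ for any unit vectors $\psi\in\pi_2^{-1}(x)$, $\phi\in\pi_2^{-1}(y)$ (well defined). The projective angle between $x$ and $y$ is $\cos^{-1}|\langle x,y\rangle|\in[0,\pi/2]$. One writes $x\perp y$ if $|\langle x,y\rangle|=0$, and for a subset $X\subset\mathbb{CP}(\mathcal{H})$, $X^\perp := \{y\in\mathbb{CP}(\mathcal{H}) : x\perp y \text{ for all } x\in X\}$. Distance: $d(x,y)$ is the distance on $\mathbb{CP}(\mathcal{H})$ (infimum of lengths of $C^1$ curves) associated with the Fubini-Study Riemannian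 metric, normalized so that $\pi_2$ is a Riemannian submersion from the unit sphere $\mathbb{S}(\mathcal{H})$ with the metric induced from the real inner product $\Re\langle\cdot,\cdot\rangle$; it is a known fact that $d(x,y)=\cos^{-1}|\langle x,y\rangle|$ for all $x,y$, so $\mathbb{CP}(\mathcal{H})$ has diameter $\pi/2$. For a non-empty subset $Y\subset\mathbb{CP}(\mathcal{H})$, $d(x,Y):=\inf\{d(x,y) : y\in Y\}$. Events and projective subspaces: an event is a bounded linear operator $E$ on $\mathcal{H}$ with $E=E^2=E^*$ (an orthogonal projection). A (complex) projective subspace of $\mathbb{CP}(\mathcal{H})$ is a set of the form $\pi_3(V^{\rm x})$ for a (unique) closed complex vector subspace $V$ of $\mathcal{H}$; its dimension is $\dim V-1$ (the empty set is the projective subspace of dimension $-1$). The map $\pi'(E):=\pi_3(({\rm Ran}\,E)^{\rm x})$ is a bijection from events to projective subspaces. *)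

(* Defs.v *)
From HB Require Import structures.
From mathcomp Require Import all_boot all_order all_algebra.
From mathcomp Require Import complex.
From mathcomp Require Import all_classical all_reals all_analysis.

Set Implicit Arguments.
Unset Strict Implicit.
Unset Printing Implicit Defensive.

Import Order.TTheory GRing.Theory Num.Theory.
Import numFieldNormedType.Exports.

Local Open Scope classical_set_scope.
Local Open Scope ring_scope.
Local Open Scope quotient_scope.

(* The inner product is linear in the second entry; conjugate linearity in
   the first entry follows from [ipC].  Completeness and the topology come
   from the complete normed module structure, whose norm (with values in
   R[i]) is tied to the inner product by [ip_norm]. *)
HB.mixin Record isHilbert (R : realType) H of CompleteNormedModule R[i] H := {
  ip : H -> H -> R[i];
  ipDZr : forall (a : R[i]) (w u v : H),
    ip w (a *: u + v) = a * ip w u + ip w v;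
  ipC : forall u v : H, ip u v = (ip v u)^*;
  ip_norm : forall u : H, ip u u = `|u| ^+ 2
}.

#[short(type="hilbertType")]
HB.structure Definition Hilbert (R : realType) :=
  {H of isHilbert R H & CompleteNormedModule R[i] H}.

Section Projective.
Context {R : realType} {H : hilbertType R}.
Implicit Types (V : set H).

Definition hnorm (u : H) : R := complex.Re `|u|.

Lemma ipZr (a : R[i]) (w u : H) : ip w (a *: u) = a * ip w u.
Proof.
have ip0 : ip w 0 = 0.
  have := ipDZr 1 w 0 0; rewrite scale1r addr0 mul1r.
  by move/(congr1 (fun z => z - ip w 0)); rewrite subrr addrK => <-.
by rewrite -[a *: u]addr0 ipDZr ip0 addr0.
Qed.

Lemma ipZl (a : R[i]) (w u : H) : ip (a *: w) u = a^* * ip w u.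
Proof. by rewrite ipC ipZr rmorphM /= [in RHS]ipC. Qed.

Definition nonzero : Type := {psi : H | psi != 0}.
Definition sphere : Type := {psi : H | `|psi| == 1}.
HB.instance Definition _ := Choice.on sphere.
HB.instance Definition _ := Choice.on nonzero.

Definition same_ray (psi phi : sphere) : bool :=
  `[< exists2 z : R[i], `|z| = 1 & val psi = z *: val phi >].

Lemma same_ray_refl : reflexive same_ray.
Proof. by move=> x; apply/asboolP; exists 1; rewrite ?normr1 ?scale1r. Qed.

Lemma same_ray_sym : symmetric same_ray.
Proof.
suff sym x y : same_ray x y -> same_ray y x by move=> x y; apply/idP/idP => /sym.
move=> /asboolP[z z1 xE]; apply/asboolP; exists z^-1; first by rewrite normfV z1 invr1.
by rewrite xE scalerA mulVf ?scale1r// -normr_eq0 z1 oner_eq0.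
Qed.

Lemma same_ray_trans : transitive same_ray.
Proof.
move=> y x z /asboolP[a a1 xE] /asboolP[b b1 yE]; apply/asboolP; exists (a * b).
  by rewrite normrM a1 b1 mulr1.
by rewrite xE yE scalerA.
Qed.

Canonical same_ray_equiv :=
  EquivRel same_ray same_ray_refl same_ray_sym same_ray_trans.

Definition CP : Type := {eq_quot same_ray_equiv}.
HB.instance Definition _ := Choice.on CP.

Lemma normalize_subproof (psi : nonzero) :
  `| `|val psi|^-1 *: val psi | == 1.
Proof.
by rewrite normrZ normfV normr_id mulVf// normr_eq0 (valP psi).
Qed.

Definition pi1 (psi : nonzero) : sphere :=
  exist _ (`|val psi|^-1 *: val psi) (normalize_subproof psi).
Definition pi2 (psi : sphere) : CP := \pi_({eq_quot same_ray_equiv}) psi.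
Definition pi3 : nonzero -> CP := pi2 \o pi1.

Lemma pi2P (psi phi : sphere) :
  pi2 psi = pi2 phi <-> exists2 z : R[i], `|z| = 1 & val psi = z *: val phi.
Proof.
by split=> [/eqmodP/asboolP|h] //; apply/eqmodP/asboolP.
Qed.

(* CP is also the quotient of the nonzero vectors by the nonzero scalars. *)
Lemma pi3P (psi phi : nonzero) :
  pi3 psi = pi3 phi <-> exists2 z : R[i], z != 0 & val psi = z *: val phi.
Proof.
have n0 (u : nonzero) : `|val u| != 0 :> R[i] by rewrite normr_eq0 (valP u).
split=> [/pi2P[z z1 /= E]|[z z0 E]]; last first.
  apply/pi2P => /=; exists (`|z|^-1 * z).
    by rewrite normrM normfV normr_id mulVf// normr_eq0.
  by rewrite E normrZ !scalerA invfM mulrAC.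
exists (`|val psi| * z * `|val phi|^-1).
  by rewrite !mulf_neq0 ?invr_eq0 ?n0// -normr_eq0 z1 oner_eq0.
by rewrite -!scalerA -E scalerA mulfV ?scale1r.
Qed.

(* Defined on chosen unit representatives; independent of them by [absipE]. *)
Definition absip (x y : CP) : R := complex.Re `|ip (val (repr x)) (val (repr y))|.

Lemma absipE (psi phi : sphere) :
  absip (pi2 psi) (pi2 phi) = complex.Re `|ip (val psi) (val phi)|.
Proof.
have rE (u : sphere) : exists2 z : R[i], `|z| = 1 &
    val (repr (pi2 u)) = z *: val u by apply/pi2P; exact: reprK.
rewrite /absip; have [a a1 ->] := rE psi; have [b b1 ->] := rE phi.
by rewrite ipZr ipZl !normrM norm_conjC a1 b1 !mul1r.
Qed.

Definition proj_angle (x y : CP) : R := acos (absip x y).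

Definition perp (x y : CP) : Prop := absip x y = 0.
Definition orthoc (X : set CP) : set CP := [set y | forall x, X x -> perp x y].

(* The library's [derive] needs domain and codomain to be normed modules over
   the same field; here the variable is real and H is a module over R[i]. *)
Definition deriv_at (c : R -> H) (t : R) (v : H) : Prop :=
  (fun h : R => (h^-1)%:C%C *: (c (t + h) - c t)) @ 0^' --> v.

(* [pi2] is a submersion, so a curve in CP is C^1 near t exactly when it is
   near t the image of a C^1 curve of the sphere. *)
Definition C1_lift (g : R -> CP) (t : R) (c : R -> sphere) (c' : R -> H) :=
  [/\ \forall s \near t, g s = pi2 (c s),
      \forall s \near t, deriv_at (fun r => val (c r)) s (c' s) &
      \forall s \near t, {for s, continuous c'}].

(* A C^1 curve on the closed interval [0, 1] is the restriction of a curve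
   that is C^1 on a neighbourhood of [0, 1]. *)
Definition C1_curve (g : R -> CP) : Prop :=
  forall t, t \in `[0, 1] -> exists c c', C1_lift g t c c'.

(* The fibre of [pi2] through psi is the circle S^1 psi, with tangent line
   R (i psi).  For v tangent to the sphere at psi, <psi, v> is purely
   imaginary and <psi, v> psi is the component of v along i psi for the inner
   product Re <.,.>. *)
Definition horizontal (psi v : H) : H := v - ip psi v *: psi.

(* [pi2] being a Riemannian submersion, the Fubini-Study norm of the velocity
   of g is the norm of the horizontal part of the velocity of any lift. *)
Definition FS_speed (g : R -> CP) (t : R) : R :=
  xget 0 [set s | exists c c',
    C1_lift g t c c' /\ s = hnorm (horizontal (val (c t)) (c' t))].

Definition FS_length (g : R -> CP) : R :=
  \int[lebesgue_measure]_(t in `[0, 1]) FS_speed g t.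

Definition FS_dist (x y : CP) : R :=
  inf [set FS_length g | g in [set g | [/\ C1_curve g, g 0 = x & g 1 = y]]].

Definition FS_dist_set (x : CP) (Y : set CP) : R :=
  inf [set FS_dist x y | y in Y].

Definition bounded_operator (E : H -> H) : Prop :=
  linear E /\ exists M : R, forall u, hnorm (E u) <= M * hnorm u.

Definition adjoint_of (E F : H -> H) : Prop :=
  bounded_operator F /\ forall u v, ip (F u) v = ip u (E v).

Definition event : set (H -> H) :=
  [set E | [/\ bounded_operator E, E \o E = E & adjoint_of E E]].

Definition closed_subspace V : Prop :=
  [/\ closed V, V 0 & forall (a : R[i]) u v, V u -> V v -> V (a *: u + v)].

Definition projectivization V : set CP :=
  [set pi3 psi | psi in [set psi : nonzero | V (val psi)]].

Definition projective_subspace (S : set CP) : Prop :=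
  exists2 V, closed_subspace V & S = projectivization V.

Definition lin_indep (n : nat) (b : 'I_n -> H) : Prop :=
  forall a : 'I_n -> R[i], \sum_i a i *: b i = 0 -> forall i, a i = 0.

Definition has_dim V (n : nat) : Prop :=
  exists2 b : 'I_n -> H, lin_indep b &
    V = [set u | exists a : 'I_n -> R[i], u = \sum_i a i *: b i].

Definition has_proj_dim (S : set CP) (m : int) : Prop :=
  exists V (n : nat), [/\ closed_subspace V, S = projectivization V,
    has_dim V n & m = n%:Z - 1].

Definition event_subspace (E : H -> H) : set CP := projectivization (range E).

(* The inverse of the bijection E |-> event_subspace E from events onto
   projective subspaces; the default 0 is only used off its image. *)
Definition subspace_event : set CP -> (H -> H) :=
  'pinv_(fun=> (fun=> 0)) event event_subspace.

Definition nearest (x : CP) (S : set CP) (y : CP) : Prop :=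
  S y /\ FS_dist_set x S = FS_dist x y.

End Projective.

Arguments CP {R} H.
Arguments sphere {R} H.
Arguments nonzero {R} H.

(* Main.v *)
Require Import Defs.
From HB Require Import structures.
From mathcomp Require Import all_boot all_order all_algebra.
From mathcomp Require Import complex.
From mathcomp Require Import all_classical all_reals all_analysis ring lra.

(** Along a curve in CP with a lift c to the sphere, the function
    p = 2 |<psi, c>|^2 - 1 = cos (2 angle) satisfies
    |p'| <= 2 speed sqrt (1 - p^2); integrating acos p bounds the length of the
    curve below by the projective angle of its endpoints, and great circles
    attain the bound, so the distance d is the projective angle.  If E is the
    orthogonal projection with range the subspace of S, then for a unit vector
    q with E q = q one has |<psi, q>| = |<E psi, q>|, and Cauchy-Schwarz bounds
    this by the norm of E psi, with equality exactly when E psi is a multiple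
    of q. *)

Set Implicit Arguments.
Unset Strict Implicit.
Unset Printing Implicit Defensive.

Import Order.TTheory GRing.Theory Num.Theory.
Import numFieldNormedType.Exports.

Local Open Scope classical_set_scope.
Local Open Scope ring_scope.

(** The overlap is squared because |<psi, c>| is not differentiable where it vanishes, while its
    square is a polynomial in two real inner products, and cos (2 angle) is affine in that square.
    The price is a doubled angle: a curve of length L is compared with 2 L, which must stay below
    pi; curves with L >= pi / 2 need no argument, since no projective angle exceeds pi / 2. Curves
    have a real parameter while H is complex, hence the constant passage from <.,.> to Re <.,.>,
    with the imaginary part recovered by pairing with ['i *: u]. [FS_speed] chooses among lifts, so
    independence of the lift has to precede any computation of a length. [subspace_event] is only a
    partial inverse, so the existence of E is the projection theorem, which is where completeness of
    H enters. *)

(** * Hermitian and real inner products, Cauchy-Schwarz, horizontal parts *)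

Section InnerProduct.
Context {R : realType} {H : hilbertType R}.
Implicit Types (u v w : H) (a z : R[i]) (k : R).

Lemma Re_sum z1 z2 : complex.Re (z1 + z2 : R[i]) = complex.Re z1 + complex.Re z2.
Proof. by case: z1; case: z2. Qed.

Lemma Re_realM k z : complex.Re (k%:C%C * z) = k * complex.Re z.
Proof. by case: z => a b /=; rewrite mul0r subr0. Qed.

Lemma Re_conj z : complex.Re z^* = complex.Re z.
Proof. by case: z. Qed.

Lemma sqr_Re_norm z :
  complex.Re `|z| ^+ 2 = complex.Re z ^+ 2 + complex.Im z ^+ 2.
Proof. by rewrite normc_def /= sqr_sqrtr// addr_ge0 ?sqr_ge0. Qed.

Lemma Re_norm_ge0 z : 0 <= complex.Re `|z|.
Proof. by rewrite normc_def/= sqrtr_ge0. Qed.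

Lemma Re_normE z : `|z| = (complex.Re `|z|)%:C%C.
Proof. by rewrite normc_def. Qed.

Lemma hnormE u : `|u| = (hnorm u)%:C%C.
Proof. by rewrite /hnorm RRe_real// normr_real. Qed.

Lemma hnorm_ge0 u : 0 <= hnorm u.
Proof. by rewrite -ler0c -hnormE. Qed.

Lemma hnorm_eq0 u : (hnorm u == 0) = (u == 0).
Proof. by rewrite -[RHS]normr_eq0 hnormE -(inj_eq (@complexI R)). Qed.

Lemma hnorm0 : hnorm (0 : H) = 0.
Proof. by apply/eqP; rewrite hnorm_eq0. Qed.

Lemma ler_hnormD u v : hnorm (u + v) <= hnorm u + hnorm v.
Proof. by rewrite -lecR rmorphD /= -!hnormE ler_normD. Qed.

Lemma hnormZ a u : hnorm (a *: u) = complex.Re `|a| * hnorm u.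
Proof. by rewrite /hnorm normrZ {1}Re_normE Re_realM. Qed.

Lemma hnormZr k u : hnorm (k%:C%C *: u) = `|k| * hnorm u.
Proof.
by rewrite hnormZ normc_def/= expr0n/= addr0 sqrtr_sqr.
Qed.

Lemma hnormN u : hnorm (- u) = hnorm u.
Proof. by rewrite /hnorm normrN. Qed.

Definition rip u v : R := complex.Re (ip u v).

Lemma ipDr w u v : ip w (u + v) = ip w u + ip w v.
Proof. by rewrite -[u]scale1r ipDZr scale1r mul1r. Qed.

Lemma ipDl w u v : ip (u + v) w = ip u w + ip v w.
Proof. by rewrite ipC ipDr rmorphD /= -!ipC. Qed.

Lemma ipNr w u : ip w (- u) = - ip w u.
Proof. by rewrite -scaleN1r ipZr mulN1r. Qed.

Lemma ipNl w u : ip (- u) w = - ip u w.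
Proof. by rewrite ipC ipNr rmorphN /= -ipC. Qed.

Lemma ipBr w u v : ip w (u - v) = ip w u - ip w v.
Proof. by rewrite ipDr ipNr. Qed.

Lemma ipBl w u v : ip (u - v) w = ip u w - ip v w.
Proof. by rewrite ipDl ipNl. Qed.

Lemma ip0r w : ip w 0 = 0.
Proof. by rewrite -(subrr 0) ipBr subrr. Qed.

Lemma ip0l w : ip 0 w = 0.
Proof. by rewrite -(subrr 0) ipBl subrr. Qed.

Lemma ipuu u : ip u u = ((hnorm u) ^+ 2)%:C%C.
Proof. by rewrite ip_norm hnormE rmorphXn. Qed.

Lemma ripC u v : rip u v = rip v u.
Proof. by rewrite /rip ipC Re_conj. Qed.

Lemma ripDr w u v : rip w (u + v) = rip w u + rip w v.
Proof. by rewrite /rip ipDr Re_sum. Qed.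

Lemma ripDl w u v : rip (u + v) w = rip u w + rip v w.
Proof. by rewrite ripC ripDr ![rip w _]ripC. Qed.

Lemma ripZr w k u : rip w (k%:C%C *: u) = k * rip w u.
Proof. by rewrite /rip ipZr Re_realM. Qed.

Lemma ripZl w k u : rip (k%:C%C *: u) w = k * rip u w.
Proof. by rewrite ripC ripZr ripC. Qed.

Lemma ripNr w u : rip w (- u) = - rip w u.
Proof. by rewrite /rip ipNr; case: (ip w u). Qed.

Lemma ripuu u : rip u u = hnorm u ^+ 2.
Proof. by rewrite /rip ipuu. Qed.

Lemma sqr_hnormD u v : hnorm (u + v) ^+ 2 = hnorm u ^+ 2 + 2 * rip u v + hnorm v ^+ 2.
Proof. by rewrite -!ripuu ripDl !ripDr [rip v u]ripC; ring. Qed.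

(** Reduces limits of real inner products to limits of norms. *)
Lemma rip_polarization u v : rip u v = (hnorm (u + v) ^+ 2 - hnorm (u - v) ^+ 2) / 4.
Proof. rewrite !sqr_hnormD hnormN ripNr; by field. Qed.

(** Conjugate linearity turns the factor ['i] into [- 'i], and Re (- i z) = Im z. A complex overlap
    can thus be differentiated as two real ones. *)
Lemma Im_ip u v : complex.Im (ip u v) = rip ('i *: u) v.
Proof. by rewrite /rip ipZl conjCi -complexiE; case: (ip u v) => a b /=; ring. Qed.

Lemma sqr_norm_ip u v :
  complex.Re `|ip u v| ^+ 2 = rip u v ^+ 2 + rip ('i *: u) v ^+ 2.
Proof. by rewrite sqr_Re_norm Im_ip. Qed.

Lemma horizontal_linear u a v w :
  horizontal u (a *: v + w) = a *: horizontal u v + horizontal u w.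
Proof.
by rewrite /horizontal ipDZr scalerDl scalerBr scalerA opprD addrACA.
Qed.

Lemma ip_horizontal u v : hnorm u = 1 -> ip u (horizontal u v) = 0.
Proof.
by move=> u1; rewrite /horizontal ipBr ipZr ipuu u1 expr1n mulr1 subrr.
Qed.

(** Pythagoras for v = horizontal u v + <u, v> u. Cauchy-Schwarz and its equality case follow by
    reading off that the left side is nonnegative, and when it vanishes. *)
Lemma sqr_hnorm_horizontal u v : hnorm u = 1 ->
  hnorm (horizontal u v) ^+ 2 = hnorm v ^+ 2 - complex.Re `|ip u v| ^+ 2.
Proof.
move=> u1; have vE : v = horizontal u v + ip u v *: u by rewrite subrK.
have h0 : rip (horizontal u v) (ip u v *: u) = 0.
  by rewrite /rip ipC ipZl ip_horizontal// mulr0 rmorph0.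
by rewrite {2}vE sqr_hnormD h0 hnormZ u1 mulr0 addr0 mulr1 addrK.
Qed.

(** The phase of u enters once conjugated and once not, and cancels. This makes horizontal norms
    depend on rays only. *)
Lemma horizontalZ u v a z : `|a| = 1 ->
  horizontal (a *: u) (z *: v) = z *: horizontal u v.
Proof.
move=> a1; rewrite /horizontal ipZr ipZl scalerA scalerBr; congr (_ - _).
rewrite scalerA; congr (_ *: _).
by rewrite -!mulrA [ip u v * a]mulrC (mulrA a^*) [a^* * a]mulrC -normCK a1 expr1n mul1r.
Qed.

Lemma cauchy_schwarz_unit u v : hnorm u = 1 -> complex.Re `|ip u v| <= hnorm v.
Proof.
move=> u1; rewrite -(ler_pXn2r (_ : 0 < 2)%N) ?nnegrE ?hnorm_ge0 ?Re_norm_ge0//.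
by rewrite -subr_ge0 -sqr_hnorm_horizontal// sqr_ge0.
Qed.

Lemma cauchy_schwarz_eq u v : hnorm u = 1 -> complex.Re `|ip u v| = hnorm v ->
  v = ip u v *: u.
Proof.
move=> u1 uv; apply/eqP; rewrite -subr_eq0 -hnorm_eq0 -sqrf_eq0.
by rewrite sqr_hnorm_horizontal// uv subrr.
Qed.

Lemma ler_rip u v : `|rip u v| <= hnorm u * hnorm v.
Proof.
have [->|u0] := eqVneq u 0; first by rewrite /rip ip0l normr0 hnorm0 mul0r.
have nu0 : hnorm u != 0 by rewrite hnorm_eq0.
have nu : 0 < hnorm u by rewrite lt_def nu0 hnorm_ge0.
rewrite -ler_pdivrMl// -{1}[(hnorm u)^-1]ger0_norm ?invr_ge0 ?hnorm_ge0// -normrM -ripZl.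
apply: le_trans (@cauchy_schwarz_unit ((hnorm u)^-1%:C%C *: u) v _); last first.
  by rewrite hnormZr ger0_norm ?invr_ge0 ?hnorm_ge0// mulVf.
by rewrite -lecR -Re_normE /rip normc_ge_Re.
Qed.

(* The derivative of the squared overlap |<u, c>|^2 along a curve c of the
   sphere is 2 Re <P, c'> with P = <u, c> u, and P - |P|^2 c is orthogonal to
   c and has squared norm q - q^2. *)
Lemma ler_overlap_derivative u c v (q := complex.Re `|ip u c| ^+ 2) :
  hnorm u = 1 -> hnorm c = 1 -> rip c v = 0 ->
  `|rip u c * rip u v + rip ('i *: u) c * rip ('i *: u) v| <=
  Num.sqrt (q - q ^+ 2) * hnorm (horizontal c v).
Proof.
move=> u1 c1 cv; set a := rip u c; set b := rip ('i *: u) c.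
have qE : q = a ^+ 2 + b ^+ 2 by rewrite /q sqr_norm_ip.
have iu1 : hnorm ('i *: u) = 1 by rewrite hnormZ normCi u1 mulr1.
have uiu : rip u ('i *: u) = 0.
  by rewrite /rip ipZr ipuu -complexiE /=; ring.
set P := a%:C%C *: u + b%:C%C *: ('i *: u).
have Pv w : rip P w = a * rip u w + b * rip ('i *: u) w by rewrite ripDl !ripZl.
have Pc : rip P c = q by rewrite Pv qE -/a -/b !expr2.
have PP : rip P P = q.
  rewrite Pv !ripDr !ripZr !ripuu u1 iu1 [rip ('i *: u) u]ripC uiu qE; ring.
(* <P, c> = q is real, so its product with ['i] has no real part. *)
have iPc : rip P ('i *: c) = 0.
  rewrite Pv.
  have -> : rip u ('i *: c) = - b.
    by rewrite /b /rip ipZr ipZl conjCi -complexiE; case: (ip u c) => ? ? /=; ring.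
  have -> : rip ('i *: u) ('i *: c) = a.
    by rewrite /a /rip ipZr ipZl conjCi mulrA mulrN -expr2 sqrCi opprK mul1r.
  by ring.
rewrite -Pv.
(* Since Re <c, v> = 0, the vertical part <c, v> c of v is a real multiple of ['i *: c], to which P
   is orthogonal. *)
have vE : v = horizontal c v + (rip ('i *: c) v)%:C%C *: ('i *: c).
  rewrite scalerA.
  have -> : (rip ('i *: c) v)%:C%C * 'i = ip c v.
    rewrite -Im_ip -complexiE; move: cv; rewrite /rip.
    case: (ip c v) => x y /= ->; apply/eqP; rewrite eq_complex/=.
    by apply/andP; split; apply/eqP; ring.
  by rewrite subrK.
(* Subtracting q c from P is free against a vector orthogonal to c, and shortens P enough for
   Cauchy-Schwarz to give the sharp factor. *)
have -> : rip P v = rip (P + (- q)%:C%C *: c) (horizontal c v).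
  rewrite {1}vE ripDr ripZr iPc mulr0 addr0 [RHS]ripDl ripZl.
  by rewrite [rip c _]/rip ip_horizontal//= mulr0 addr0.
apply: le_trans (ler_rip _ _) _; rewrite ler_wpM2r ?hnorm_ge0//.
rewrite -[leLHS]ger0_norm ?hnorm_ge0// -sqrtr_sqr.
apply: ler_wsqrtr; rewrite sqr_hnormD ripZr Pc hnormZr c1 -ripuu PP mulr1 real_normK ?num_real//.
by rewrite le_eqVlt; apply/orP; left; apply/eqP; ring.
Qed.

Lemma linear_combination_unit (psi v : H) (c s : R) :
  hnorm psi = 1 -> ip psi v = 0 -> c ^+ 2 + s ^+ 2 * hnorm v ^+ 2 = 1 ->
  hnorm (c%:C%C *: psi + s%:C%C *: v) = 1.
Proof.
move=> p1 pv cs; apply/eqP; rewrite -[_ == 1](@eqrXn2 _ 2)// ?hnorm_ge0//.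
rewrite sqr_hnormD ripZl ripZr {1}/rip pv/= !hnormZr p1 !mulr0 addr0 mulr1 expr1n.
by rewrite exprMn !real_normK ?num_real// cs.
Qed.

End InnerProduct.

(** * Limits in H, lifts of curves and the Fubini-Study speed *)

Section Convergence.
Context {R : realType} {H : hilbertType R}.

(** A positive element of [R[i]] is real, so the complex epsilons of the norm of H may be taken
    real. *)
Lemma cvg_hnormP {T : Type} (F : set_system T) {FF : Filter F} (f : T -> H) (l : H) :
  f @ F --> l <-> (forall e : R, 0 < e -> \forall x \near F, hnorm (l - f x) < e).
Proof.
split=> [/cvgrPdist_lt fl e e0|fl].
  have /fl : 0 < e%:C%C by rewrite ltcR.
  by apply: filterS => x; rewrite hnormE ltcR.
apply/cvgrPdist_lt => e e0.
have eE : e = (complex.Re e)%:C%C by rewrite RRe_real// gtr0_real.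
have /fl : 0 < complex.Re e by rewrite -ltcR -eE.
by rewrite eE; apply: filterS => x; rewrite hnormE ltcR.
Qed.

Lemma ler_dist_hnorm (u v : H) : `|hnorm u - hnorm v| <= hnorm (u - v).
Proof.
have h w z : hnorm w - hnorm z <= hnorm (w - z :> H).
  by rewrite lerBlDr -{1}(subrK z w) ler_hnormD.
by rewrite ler_norml h andbT lerNl opprB -[u - v]opprB hnormN h.
Qed.

Lemma cvg_hnorm {T : Type} (F : set_system T) {FF : Filter F} (f : T -> H) (l : H) :
  f @ F --> l -> hnorm (f x) @[x --> F] --> hnorm l.
Proof.
move=> /cvg_hnormP fl; apply/cvgrPdist_lt => e /fl.
by apply: filterS => x; apply: le_lt_trans; exact: ler_dist_hnorm.
Qed.

Lemma cvg_rip {T : Type} (F : set_system T) {FF : Filter F} (f g : T -> H) (u v : H) :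
  f @ F --> u -> g @ F --> v -> rip (f x) (g x) @[x --> F] --> rip u v.
Proof.
move=> fu gv; rewrite rip_polarization.
under eq_cvg do rewrite rip_polarization !expr2.
rewrite !expr2; apply: cvgMl; apply: cvgB.
- by apply: cvgM; apply: cvg_hnorm; apply: cvgD.
- by apply: cvgM; apply: cvg_hnorm; apply: cvgB.
Qed.

Lemma hnorm_sphere (p : sphere H) : hnorm (val p) = 1.
Proof. by rewrite /hnorm (eqP (valP p)). Qed.

Lemma hnorm_horizontalE (u v : H) : hnorm u = 1 ->
  hnorm (horizontal u v) =
  Num.sqrt (hnorm v ^+ 2 - (rip u v ^+ 2 + rip ('i *: u) v ^+ 2)).
Proof.
move=> u1; rewrite -sqr_norm_ip -sqr_hnorm_horizontal//.
by rewrite sqrtr_sqr ger0_norm// hnorm_ge0.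
Qed.

Lemma cvg_hnorm_horizontal {T : Type} (F : set_system T) {FF : Filter F}
    (f : T -> sphere H) (g : T -> H) (u : sphere H) (v : H) :
  (fun x => val (f x)) @ F --> val u -> g @ F --> v ->
  hnorm (horizontal (val (f x)) (g x)) @[x --> F] --> hnorm (horizontal (val u) v).
Proof.
move=> fu gv; rewrite hnorm_horizontalE ?hnorm_sphere//.
under eq_cvg do rewrite hnorm_horizontalE ?hnorm_sphere// !expr2.
apply: (continuous_cvg _ (@sqrt_continuous R _)); rewrite !expr2.
apply: cvgB; first by apply: cvgM; exact: cvg_hnorm.
by apply: cvgD; apply: cvgM; apply: cvg_rip => //; apply: cvgZr.
Qed.

Lemma deriv_at_continuous (c : R -> H) (t : R) (v : H) :
  deriv_at c t v -> {for t, continuous c}.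
Proof.
move=> cv; apply/cvg_hnormP => e e0.
(* Near 0 the difference quotients have norm below [hnorm v + 1]; the added 1 leaves room above
   their limit and keeps the bound positive when v = 0. *)
have K0 : 0 < hnorm v + 1 by rewrite ltr_wpDl ?hnorm_ge0.
have : \forall h \near 0^', hnorm (h^-1%:C%C *: (c (t + h) - c t)) < hnorm v + 1.
  by apply: (cvgr_lt _ (cvg_hnorm cv)); rewrite ltrDl.
rewrite near_withinE => cb.
have hs : \forall h \near (0 : R), `|h| < e / (hnorm v + 1).
  by exists (e / (hnorm v + 1)); rewrite /= ?divr_gt0// => h; rewrite /= sub0r normrN.
suff : \forall s \near t, hnorm (c t - c s) < e by [].
rewrite (near_shift 0 t); near=> h; rewrite /= /shift/= subr0 [h + t]addrC.
have [->|h0] := eqVneq h 0; first by rewrite addr0 subrr hnorm0.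
have : hnorm (h^-1%:C%C *: (c (t + h) - c t)) < hnorm v + 1.
  by move: h0; near: h.
rewrite hnormZr -hnormN opprB normfV ltr_pdivrMl ?normr_gt0// => /lt_trans; apply.
by rewrite -ltr_pdivlMr//; near: h.
Unshelve. all: by end_near. Qed.

Lemma is_derive_rip (w : H) (c : R -> H) (t : R) (v : H) :
  deriv_at c t v -> is_derive t 1 (fun s => rip w (c s)) (rip w v).
Proof.
move=> cv.
have L : (fun h => h^-1 *: (((fun s => rip w (c s)) \o shift t) (h *: 1) - rip w (c t))) @ 0^'
    --> rip w v.
  apply: cvg_trans (cvg_rip (cvg_cst w) cv); apply: near_eq_cvg.
  near=> h; rewrite ripZr ripDr ripNr /= /GRing.scale/= mulr1 [h + t]addrC//.
apply: DeriveDef; first exact: cvgP L.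
exact: cvg_lim L.
Unshelve. all: by end_near. Qed.

Lemma horizontal_self (u : H) : hnorm u = 1 -> horizontal u u = 0.
Proof. by move=> u1; rewrite /horizontal ipuu u1 expr1n scale1r subrr. Qed.

Lemma horizontalZr (u v : H) (a : R[i]) : horizontal u (a *: v) = a *: horizontal u v.
Proof. by have := horizontalZ u v a (normr1 _); rewrite scale1r. Qed.

Lemma hnorm_horizontal_pi2 (a b p q : sphere H) : pi2 a = pi2 p -> pi2 b = pi2 q ->
  hnorm (horizontal (val a) (val b)) = hnorm (horizontal (val p) (val q)).
Proof.
move=> /pi2P[y y1 ->] /pi2P[z z1 ->].
by rewrite horizontalZ// hnormZ z1 mul1r.
Qed.

(** The subtracted vector [c t] has no horizontal part at itself, so only the rays of [c t] and
    [c (t + h)] matter. *)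
Lemma hnorm_horizontal_quotient (c : R -> sphere H) (t h : R) :
  hnorm (horizontal (val (c t)) (h^-1%:C%C *: (val (c (t + h)) - val (c t)))) =
  `|h^-1| * hnorm (horizontal (val (c t)) (val (c (t + h)))).
Proof.
rewrite horizontalZr hnormZr -[_ - _]addrC -scaleN1r horizontal_linear.
by rewrite horizontal_self ?hnorm_sphere// scaler0 add0r.
Qed.

(* The speed is the limit of |h|^-1 sqrt (1 - |<c t, c (t + h)>|^2), which
   depends on the projected curve only. *)
Lemma C1_lift_speed_unique (g : R -> CP H) (t : R) (c d : R -> sphere H) (c' d' : R -> H) :
  C1_lift g t c c' -> C1_lift g t d d' ->
  hnorm (horizontal (val (c t)) (c' t)) = hnorm (horizontal (val (d t)) (d' t)).
Proof.
move=> [gc cD _] [gd dD _].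
have cL := cvg_hnorm_horizontal (f := fun=> c t) (cvg_cst (val (c t))) (nbhs_singleton cD).
have dL := cvg_hnorm_horizontal (f := fun=> d t) (cvg_cst (val (d t))) (nbhs_singleton dD).
suff cdL : hnorm (horizontal (val (c t)) (h^-1%:C%C *: (val (c (t + h)) - val (c t))))
    @[h --> 0^'] --> hnorm (horizontal (val (d t)) (d' t)).
  exact: (cvg_unique (@norm_hausdorff R R) (cL _ _) cdL).
apply: cvg_trans (dL _ _); apply: near_eq_cvg.
have cd : \forall h \near (0 : R), pi2 (c (t + h)) = pi2 (d (t + h)).
  suff : \forall s \near t, pi2 (c s) = pi2 (d s).
    by rewrite (near_shift 0 t); apply: filterS => h; rewrite /= /shift/= subr0 [h + t]addrC.
  by near=> s; rewrite -(near gc s)// -(near gd s).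
rewrite near_withinE; apply: filterS cd => h cdh _.
rewrite !hnorm_horizontal_quotient; congr (_ * _).
apply: hnorm_horizontal_pi2 => //.
by rewrite -(nbhs_singleton gc) -(nbhs_singleton gd).
Unshelve. all: by end_near. Qed.

(** Independence of the lift makes the set inside [FS_speed] a singleton, so the default 0 of [xget]
    does not occur where a lift exists. *)
Lemma FS_speedE (g : R -> CP H) (t : R) (c : R -> sphere H) (c' : R -> H) :
  C1_lift g t c c' -> FS_speed g t = hnorm (horizontal (val (c t)) (c' t)).
Proof.
move=> gc; apply: xget_unique; first by exists c, c'.
by move=> _ [d [d' [gd ->]]]; exact: C1_lift_speed_unique gd gc.
Qed.

Lemma C1_lift_near (g : R -> CP H) (t : R) (c : R -> sphere H) (c' : R -> H) :
  C1_lift g t c c' -> \forall s \near t, C1_lift g s c c'.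
Proof.
move=> [/nbhs_interior gc /nbhs_interior cD /nbhs_interior cc].
by near=> s; split; near: s.
Unshelve. all: by end_near. Qed.

Lemma FS_speed_continuous (g : R -> CP H) (t : R) (c : R -> sphere H) (c' : R -> H) :
  C1_lift g t c c' -> {for t, continuous (FS_speed g)}.
Proof.
move=> gc; have [_ cD cc] := gc.
have ct := deriv_at_continuous (nbhs_singleton cD).
rewrite /prop_for /continuous_at (FS_speedE gc).
apply: cvg_trans (cvg_hnorm_horizontal ct (nbhs_singleton cc)).
apply: near_eq_cvg.
by apply: filterS (C1_lift_near gc) => s /FS_speedE ->.
Qed.

Lemma FS_speed_ge0 (g : R -> CP H) (t : R) : 0 <= FS_speed g t.
Proof. by rewrite /FS_speed; case: xgetP => // _ -> [c [c' [_ ->]]]; exact: hnorm_ge0. Qed.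

End Convergence.

(** * From the differential inequality to a bound on the cosine of the length *)

Section ArcLength.
Context {R : realType}.
Notation mu := (@lebesgue_measure R).

Lemma continuous_in_itv_integrable (f : R -> R) (a b : R) :
  {in `[a, b], forall t, {for t, continuous f}} ->
  {within `[a, b], continuous f} /\ mu.-integrable `[a, b] (EFin \o f).
Proof.
move=> cf; have wf : {within `[a, b], continuous f}.
  by apply: continuous_in_subspaceT => t /set_mem tab; exact: cf.
by split=> //; apply: continuous_compact_integrable => //; exact: segment_compact.
Qed.

(* The differential inequality says that acos p grows at rate at most s, but
   acos is not differentiable at 1 and -1; scaling p by cos d < 1 keeps the
   inequality and avoids these two points. *)
Lemma ler_acos_arc (p s : R -> R) (d : R) :
  0 < d < pi / 2 ->
  {in `[0, 1], forall t, derivable p t 1} ->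
  {in `[0, 1], forall t, -1 <= p t <= 1} ->
  {in `[0, 1], forall t, `|'D_1 p t| <= Num.sqrt (1 - p t ^+ 2) * s t} ->
  {in `[0, 1], forall t, {for t, continuous s}} ->
  (forall t, 0 <= s t) -> p 0 = 1 ->
  acos (cos d * p 1) <= \int[mu]_(t in `[0, 1]) s t + d.
Proof.
move=> /andP[d0 dpi] dp p1 ps cs s0 p01.
have [_ si] := continuous_in_itv_integrable cs.
have r0 : 0 < cos d by rewrite cos_gt0_pihalf// dpi (lt_trans _ d0)// oppr_lt0 divr_gt0// pi_gt0.
have dpi' : d < pi by apply: lt_trans dpi _; rewrite ltr_pdivrMr// mulr_natr mulr2n ltrDl pi_gt0.
have r1 : cos d < 1.
  by rewrite -[ltRHS]cos0 ltr_cos// in_itv/= ?lexx ?pi_ge0// !ltW.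
have rp (t : R) : t \in `[0, 1] -> -1 < cos d * p t < 1.
  move=> /p1 /andP[pl pu]; apply/andP; split; nra.
pose F := acos \o (cos d *: p).
pose L x := \int[mu]_(t in `[0, x]) s t.
have dF (t : R) : t \in `[0, 1] -> is_derive t 1 F
    (- (Num.sqrt (1 - (cos d * p t) ^+ 2))^-1 * (cos d *: 'D_1 p t)).
  move=> t01; apply: is_derive1_comp; first exact: (is_derive1_acos (rp _ t01)).
  by apply: is_deriveZ; apply: derivableP; exact: dp.
have dL (t : R) : t \in `]0, 1[ -> derivable L t 1 /\ 'D_1 L t = s t.
  rewrite in_itv/= => /andP[t0 t1].
  rewrite -derive1E; apply: (continuous_FTC1_closed t1 si t0); apply: cs.
  by rewrite in_itv/= !ltW.
have ooW (t : R) : t \in `]0, 1[ -> t \in `[0, 1].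
  by rewrite !in_itv/= => /andP[/ltW -> /ltW ->].
have dG (t : R) : t \in `]0, 1[ -> derivable (F - L) t 1.
  move=> t01; apply: derivableB; last by case: (dL t t01).
  by case: (dF t (ooW _ t01)).
have dG0 (t : R) : t \in `]0, 1[ -> derive1 (F - L) t <= 0.
  move=> t01; have [DL L'] := dL t t01; have DF := dF t (ooW _ t01).
  have DF' : derivable F t 1 by case: DF.
  rewrite derive1E deriveB//.
  rewrite (@derive_val _ _ _ _ _ _ _ DF) L' subr_le0.
  have /andP[rpl rpu] := rp t (ooW _ t01); have /andP[pl pu] := p1 t (ooW _ t01).
  set q := p t in rpl rpu pl pu *.
  have w0 : 0 < 1 - (cos d * q) ^+ 2.
    by rewrite -[X in X - _](expr1n _ 2) subr_sqr mulr_gt0 ?subr_gt0// -ltrBlDl sub0r.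
  have sw0 : 0 < Num.sqrt (1 - (cos d * q) ^+ 2) by rewrite sqrtr_gt0.
  rewrite mulNr -mulrN mulrC ler_pdivrMr// /GRing.scale/=.
  apply: le_trans (ler_norm _) _; rewrite normrN normrM gtr0_norm//.
  apply: le_trans (ler_wpM2l (ltW r0) (ps t (ooW _ t01))) _.
  rewrite mulrA -/q [leRHS]mulrC ler_wpM2r//.
  (* What is left is cos d sqrt (1 - q^2) <= sqrt (1 - (cos d q)^2); the condition 0 < cos d < 1
     gives both halves. *)
  apply: le_trans (_ : Num.sqrt (1 - q ^+ 2) <= _).
    by rewrite ler_piMl ?sqrtr_ge0// ltW.
  apply: ler_wsqrtr; rewrite lerB// exprMn ler_piMl ?sqr_ge0//.
have cG : {within `[0, 1], continuous (F - L)}.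
  have cF : {within `[0, 1], continuous F}.
    by apply: derivable_within_continuous => t t01; case: (dF t t01).
  have cL := parameterized_integral_continuous ler01 si.
  by move=> t; apply: cvgB; [exact: cF|exact: cL].
have i0 : (0 : R) \in `[0, 1] by rewrite in_itv/= lexx ler01.
have i1 : (1 : R) \in `[0, 1] by rewrite in_itv/= lexx ler01.
have : F 1 - L 1 <= F 0 - L 0.
  exact: (ler0_derive1_le_cc dG dG0 cG i1 i0 ler01).
have -> : F 1 = acos (cos d * p 1) by [].
(* The error term d of the bound is the starting value acos (cos d). *)
have -> : F 0 = d.
  rewrite (_ : F 0 = acos (cos d * p 0))// p01 mulr1.
  by rewrite cosK// in_itv/= (ltW d0) (ltW dpi').
by rewrite {2}/L set_itv1 Rintegral_set1 subr0 lerBlDr addrC.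
Qed.

(** Taking cosines in the scaled bound and letting d tend to 0 from the right removes the
    scaling. *)
Lemma cos_arc_le (p s : R -> R) (L := \int[mu]_(t in `[0, 1]) s t) :
  {in `[0, 1], forall t, derivable p t 1} ->
  {in `[0, 1], forall t, -1 <= p t <= 1} ->
  {in `[0, 1], forall t, `|'D_1 p t| <= Num.sqrt (1 - p t ^+ 2) * s t} ->
  {in `[0, 1], forall t, {for t, continuous s}} ->
  (forall t, 0 <= s t) -> p 0 = 1 -> L <= pi ->
  cos L <= p 1.
Proof.
move=> dp pb ps cs s0 p0 Lpi.
have i1 : (1 : R) \in `[0, 1] by rewrite in_itv/= lexx ler01.
have /andP[pl pu] := pb 1 i1.
have L0 : 0 <= L by apply: Rintegral_ge0 => t _; exact: s0.
(* For L = pi the claim is -1 <= p 1. Otherwise L + d <= pi for small d, which keeps the argument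
   where cos is decreasing. *)
move: Lpi; rewrite le_eqVlt => /predU1P[->|Lpi]; first by rewrite cospi.
have cl : cos (L + d) @[d --> 0^'+] --> cos L.
  apply: (continuous_cvg _ (@continuous_cos R _)).
  by rewrite -[X in _ --> X]addr0; apply: cvgD; [exact: cvg_cst|exact: cvg_at_right_filter].
have cr : cos d * p 1 @[d --> 0^'+] --> p 1.
  rewrite -[X in _ --> X]mul1r; apply: cvgMl; rewrite -cos0.
  by apply: cvg_at_right_filter; exact: continuous_cos.
apply: (ler_cvg_to cl cr); near=> d.
have d0 : 0 < d by near: d; exact: nbhs_right_gt.
have dpi : d < pi / 2 by near: d; apply: nbhs_right_lt; rewrite divr_gt0// pi_gt0.
have dL : d < pi - L by near: d; apply: nbhs_right_lt; rewrite subr_gt0.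
have c0 : 0 < cos d.
  by rewrite cos_gt0_pihalf// dpi (lt_trans _ d0)// oppr_lt0 divr_gt0// pi_gt0.
have c1 := cos_le1 d.
have cp : -1 <= cos d * p 1 <= 1 by apply/andP; split; nra.
have := @ler_acos_arc p s d; rewrite d0 dpi => /(_ isT dp pb ps cs s0 p0) h.
rewrite -[leRHS]acosK ?in_itv//=.
have a1 : acos (cos d * p 1) \in `[0, pi] by rewrite in_itv/= acos_ge0// acos_lepi.
have a2 : L + d \in `[0, pi] by rewrite in_itv/= addr_ge0 ?(ltW d0)//= -lerBrDl ltW.
by rewrite leNgt ltr_cos// -leNgt.
Unshelve. all: by end_near. Qed.

End ArcLength.

(** * The projective angle bounds the length of curves from below *)

Section FubiniStudyDistance.
Context {R : realType} {H : hilbertType R}.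
Notation mu := (@lebesgue_measure R).
Implicit Types (x y : CP H) (g : R -> CP H) (c : R -> sphere H).

Lemma pi2_surj x : exists psi : sphere H, pi2 psi = x.
Proof. by exists (repr x); exact: reprK. Qed.

Lemma absip_ge0 x y : 0 <= absip x y.
Proof. exact: Re_norm_ge0. Qed.

Lemma absip_le1 x y : absip x y <= 1.
Proof.
have [psi <-] := pi2_surj x; have [phi <-] := pi2_surj y.
by rewrite absipE -(hnorm_sphere phi) cauchy_schwarz_unit// hnorm_sphere.
Qed.

Lemma absip_itv x y : -1 <= absip x y <= 1.
Proof. by rewrite absip_le1 andbT (le_trans _ (absip_ge0 x y))// lerN10. Qed.

Lemma cos_proj_angle x y : cos (proj_angle x y) = absip x y.
Proof. by rewrite acosK// in_itv/= absip_itv. Qed.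

Lemma proj_angle_ge0 x y : 0 <= proj_angle x y.
Proof. by rewrite acos_ge0// absip_itv. Qed.

Lemma proj_angle_lepi x y : proj_angle x y <= pi.
Proof. by rewrite acos_lepi// absip_itv. Qed.

Lemma ler_proj_angle x y x' y' :
  (proj_angle x y <= proj_angle x' y') = (absip x' y' <= absip x y).
Proof.
rewrite -!cos_proj_angle [RHS]leNgt ltr_cos ?in_itv/= ?proj_angle_ge0 ?proj_angle_lepi//.
by rewrite -leNgt.
Qed.

Lemma proj_angle_inj x y x' y' :
  proj_angle x y = proj_angle x' y' -> absip x y = absip x' y'.
Proof. by rewrite -!cos_proj_angle => ->. Qed.

Lemma proj_angle_le_pihalf x y : proj_angle x y <= pi / 2.
Proof.
have h : pi / 2 \in `[(0 : R), pi].
  by rewrite in_itv/= divr_ge0 ?pi_ge0//= ler_pdivrMr// mulr_natr mulr2n lerDl pi_ge0.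
rewrite leNgt -ltr_cos ?h//; last by rewrite in_itv/= proj_angle_ge0 proj_angle_lepi.
by rewrite cos_proj_angle cos_pihalf -leNgt absip_ge0.
Qed.

(** Expanding |c t + h q|^2 = 1 for the difference quotient q gives Re <c t, q> = - (h / 2) |q|^2,
    which tends to 0 because |q| converges. *)
Lemma rip_velocity_sphere c (t : R) (v : H) :
  deriv_at (fun s => val (c s)) t v -> rip (val (c t)) v = 0.
Proof.
move=> cv.
have L := cvg_rip (cvg_cst (val (c t))) cv.
suff L0 : rip (val (c t)) (h^-1%:C%C *: (val (c (t + h)) - val (c t))) @[h --> 0^'] --> (0 : R).
  exact: (cvg_unique (@norm_hausdorff R R) (L _ _) L0).
have Lh : - (h / 2) * hnorm (h^-1%:C%C *: (val (c (t + h)) - val (c t))) ^+ 2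
    @[h --> 0^'] --> - (0 / 2) * hnorm v ^+ 2.
  apply: cvgM; last by rewrite expr2; under eq_cvg do rewrite expr2; apply: cvgM; exact: cvg_hnorm.
  apply: cvgN; apply: cvgMl; apply: cvg_within_filter; exact: cvg_id.
rewrite !mul0r oppr0 mul0r in Lh.
apply: cvg_trans Lh; apply: near_eq_cvg; rewrite near_withinE; near=> h => h0.
set q := h^-1%:C%C *: _.
have qE : val (c (t + h)) = val (c t) + h%:C%C *: q.
  by rewrite scalerA -rmorphM/= mulfV// scale1r [RHS]addrC subrK.
have := hnorm_sphere (c (t + h)); move/(congr1 (fun z => z ^+ 2)).
rewrite qE sqr_hnormD ripZr hnorm_sphere hnormZr exprMn real_normK ?num_real//.
rewrite expr1n -addrA => /(congr1 (fun z => z - 1)); rewrite addrAC subrr add0r => e.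
set r := rip _ _ in e *; set n := hnorm _ ^+ 2 in e *.
apply: (mulfI h0); apply/eqP; rewrite -subr_eq0; apply/eqP.
have -> : h * (- (h / 2) * n) - h * r = - ((2 * (h * r) + h ^+ 2 * n) / 2) by field.
by rewrite e mul0r oppr0.
Unshelve. all: by end_near. Qed.

(** With q the squared overlap, p' = 4 (a a' + b b') and 1 - p^2 = 4 (q - q^2): one factor 2 goes
    into the square root, the other stays with the speed, as it should for a doubled angle. *)
Lemma overlap_derivative (psi : sphere H) g (t : R) c (c' : R -> H) :
  C1_lift g t c c' ->
  let p s := 2 * absip (pi2 psi) (g s) ^+ 2 - 1 in
  derivable p t 1 /\ `|'D_1 p t| <= Num.sqrt (1 - p t ^+ 2) * (2 * FS_speed g t).
Proof.
move=> gc p; have [gE /nbhs_singleton cD _] := gc.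
pose a s := rip (val psi) (val (c s)); pose b s := rip ('i *: val psi) (val (c s)).
have ga : \forall s \near t, 2 * (a s * a s + b s * b s) - 1 = p s.
  by apply: filterS gE => s gs; rewrite /p gs absipE sqr_norm_ip !expr2.
have Da := is_derive_rip (val psi) cD; have Db := is_derive_rip ('i *: val psi) cD.
set a' := rip _ _ in Da; set b' := rip _ _ in Db.
have Dp : is_derive t 1 p (4 * (a t * a' + b t * b')).
  apply: (near_eq_is_derive ga).
  have D := is_deriveB (is_deriveZ 2 (is_deriveD (is_deriveM Da Da) (is_deriveM Db Db)))
    (is_derive_cst (1 : R) t 1).
  apply: (@is_derive_eq _ _ _ _ _ _ _ _ D).
  rewrite /GRing.scale/= /a /b; ring.
split; first by case: Dp.
rewrite (@derive_val _ _ _ _ _ _ _ Dp) (FS_speedE gc).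
have := ler_overlap_derivative (hnorm_sphere psi) (hnorm_sphere (c t)) (rip_velocity_sphere cD).
rewrite -/(a t) -/(b t) -/a' -/b' -absipE -(nbhs_singleton gE) => h.
have -> : 1 - p t ^+ 2 = 2 ^+ 2 * (absip (pi2 psi) (g t) ^+ 2 - (absip (pi2 psi) (g t) ^+ 2) ^+ 2).
  by rewrite /p; ring.
rewrite sqrtrM ?sqr_ge0// sqrtr_sqr normrM.
rewrite [X in X * _ <= _]ger0_norm// [X in _ <= X * _ * _]ger0_norm//.
by rewrite mulrCA mulrA (mulrA 2) -natrM -mulrA ler_wpM2l.
Qed.

Lemma proj_angle_le_length g x y :
  C1_curve g -> g 0 = x -> g 1 = y -> proj_angle x y <= FS_length g.
Proof.
move=> Cg g0 g1; have [psi psix] := pi2_surj x.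
have [piL|Lpi] := lerP (pi / 2) (FS_length g).
  exact: le_trans (proj_angle_le_pihalf x y) piL.
pose p s := 2 * absip (pi2 psi) (g s) ^+ 2 - 1.
have cs : {in `[0, 1], forall t, {for t, continuous (FS_speed g)}}.
  by move=> t /Cg[c [c' gc]]; exact: FS_speed_continuous gc.
have [_ si] := continuous_in_itv_integrable cs.
have LE : \int[mu]_(t in `[0, 1]) (2 * FS_speed g t) = 2 * FS_length g.
  by rewrite RintegralZl.
have L0 : 0 <= FS_length g by apply: Rintegral_ge0 => t _; exact: FS_speed_ge0.
have : cos (\int[mu]_(t in `[0, 1]) (2 * FS_speed g t)) <= p 1.
  apply: cos_arc_le.
  - by move=> t /Cg[c [c' gc]]; case: (overlap_derivative psi gc).
  - move=> t _; rewrite /p; have := absip_le1 (pi2 psi) (g t).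
    have := absip_ge0 (pi2 psi) (g t); set z := absip _ _ => z0 z1.
    by apply/andP; split; nra.
  - by move=> t /Cg[c [c' gc]]; case: (overlap_derivative psi gc).
  - by move=> t t01; apply: cvgMr; exact: cs.
  - by move=> t; rewrite mulr_ge0// FS_speed_ge0.
  - rewrite /p g0 psix -cos_proj_angle /proj_angle.
    have [phi <-] := pi2_surj x; rewrite absipE ipuu hnorm_sphere expr1n normr1.
    by rewrite acos1 cos0; ring.
  - by rewrite LE; lra.
rewrite LE /p g1 psix -cos_proj_angle.
(* The double angle formula reduces the bound to cos L ^ 2 <= |<x, y>| ^ 2. Squares can be compared
   because L < pi / 2 makes cos L nonnegative. *)
have -> : 2 * FS_length g = FS_length g *+ 2 by rewrite mulr_natl.
rewrite cos_mulr2n -mulr_natl lerD2r ler_pM2l// => cosL.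
have Lpih : FS_length g \in `[0, pi].
  rewrite in_itv/= L0 (le_trans (ltW Lpi))// ler_pdivrMr// mulr_natr mulr2n lerDl.
  exact: pi_ge0.
rewrite leNgt -ltr_cos//; last by rewrite in_itv/= proj_angle_ge0 proj_angle_lepi.
rewrite -leNgt -(ler_pXn2r (_ : 0 < 2)%N)// nnegrE.
  by rewrite cos_ge0_pihalf// (ltW Lpi) (le_trans _ L0)// oppr_le0 divr_ge0 ?pi_ge0.
by rewrite cos_proj_angle absip_ge0.
Qed.

End FubiniStudyDistance.

(** * Horizontal great circles and their length *)

Section GreatCircle.
Context {R : realType} {H : hilbertType R}.
Notation mu := (@lebesgue_measure R).

Lemma cvg_realZ {T : Type} (F : set_system T) {FF : Filter F} (f : T -> R) (k : R) (u : H) :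
  f @ F --> k -> (f x)%:C%C *: u @[x --> F] --> k%:C%C *: u.
Proof.
move=> fk; apply/cvg_hnormP => e e0.
have u0 : 0 < hnorm u + 1 by rewrite ltr_wpDl ?hnorm_ge0.
move/cvgrPdist_lt : fk => /(_ (e / (hnorm u + 1))).
rewrite divr_gt0// => /(_ isT); apply: filterS => x.
rewrite ltr_pdivlMr// => fx; rewrite -scalerBl -rmorphB/= hnormZr.
by apply: le_lt_trans fx; rewrite ler_wpM2l// lerDl.
Qed.

Lemma is_derive_cvg (f : R -> R) (t df : R) : is_derive t 1 f df ->
  h^-1 * (f (t + h) - f t) @[h --> 0^'] --> df.
Proof.
move=> [fd <-]; apply: cvg_trans fd; apply: near_eq_cvg; near=> h.
by rewrite /GRing.scale/= mulr1 [h + t]addrC.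
Unshelve. all: by end_near. Qed.

Lemma deriv_at_comb (f1 f2 : R -> R) (t d1 d2 : R) (u v : H) :
  is_derive t 1 f1 d1 -> is_derive t 1 f2 d2 ->
  deriv_at (fun s => (f1 s)%:C%C *: u + (f2 s)%:C%C *: v) t (d1%:C%C *: u + d2%:C%C *: v).
Proof.
move=> /is_derive_cvg D1 /is_derive_cvg D2.
have L1 : (h^-1 * (f1 (t + h) - f1 t))%:C%C *: u @[h --> 0^'] --> d1%:C%C *: u.
  exact: cvg_realZ.
have L2 : (h^-1 * (f2 (t + h) - f2 t))%:C%C *: v @[h --> 0^'] --> d2%:C%C *: v.
  exact: cvg_realZ.
apply: cvg_trans (cvgD L1 L2).
apply: near_eq_cvg; near=> h.
rewrite /= opprD addrACA -!scalerBl scalerDr !scalerA -!rmorphB -!rmorphM//=.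
Unshelve. all: by end_near. Qed.

Lemma conj_realC (k : R) : (k%:C%C : R[i])^* = k%:C%C.
Proof. exact: conjc_real. Qed.

Variables (psi : sphere H) (v : H) (th : R).
Hypotheses (th0 : 0 <= th) (pv : ip (val psi) v = 0) (v1 : th = 0 \/ hnorm v = 1).

(** The alternative th = 0 in [v1] covers coinciding endpoints: the circle is then constant and v
    need not be a unit vector. *)
Let circle (t : R) : H := (cos (t * th))%:C%C *: val psi + (sin (t * th))%:C%C *: v.

Let circle_unit t : `|circle t| == 1.
Proof.
rewrite hnormE linear_combination_unit//; first exact: hnorm_sphere.
case: v1 => ->; first by rewrite mulr0 cos0 sin0 expr0n mul0r expr1n addr0.
by rewrite expr1n mulr1 cos2Dsin2.
Qed.

Let gc (t : R) : sphere H := exist _ (circle t) (circle_unit t).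

Let gc' (t : R) : H :=
  (- (th * sin (t * th)))%:C%C *: val psi + (th * cos (t * th))%:C%C *: v.

Let is_derive_lin (t : R) : is_derive t 1 (fun s : R => s * th) th.
Proof.
have D := is_deriveM (is_derive_id t 1) (is_derive_cst th t 1).
by apply: (@is_derive_eq _ _ _ _ _ _ _ _ D); rewrite /GRing.scale/= mulr0 add0r mulr1.
Qed.

Let gc_deriv (t : R) : deriv_at (fun s => val (gc s)) t (gc' t).
Proof.
apply: deriv_at_comb.
- have D := @is_derive1_comp R cos (fun s => s * th) t _ _ (is_derive_cos _) (is_derive_lin t).
  by apply: (@is_derive_eq _ _ _ _ _ _ _ _ D); rewrite mulNr mulrC.
- have D := @is_derive1_comp R sin (fun s => s * th) t _ _ (is_derive_sin _) (is_derive_lin t).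
  by apply: (@is_derive_eq _ _ _ _ _ _ _ _ D); rewrite mulrC.
Qed.

Let gc'_continuous (t : R) : {for t, continuous gc'}.
Proof.
have Ml : (s * th) @[s --> t] --> t * th by apply: cvgMl; exact: cvg_id.
apply: cvgD; apply: cvg_realZ.
- by apply: cvgN; apply: cvgMr; apply: (continuous_cvg _ (@continuous_sin R _)).
- by apply: cvgMr; apply: (continuous_cvg _ (@continuous_cos R _)).
Qed.

Let gc_lift (t : R) : C1_lift (pi2 \o gc) t gc gc'.
Proof.
split; near=> s; [by []|exact: gc_deriv|exact: gc'_continuous].
Unshelve. all: by end_near. Qed.

Let gc_speed (t : R) : FS_speed (pi2 \o gc) t = th.
Proof.
rewrite (FS_speedE (gc_lift t)); set C := cos (t * th); set S := sin (t * th).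
have CS : C ^+ 2 + S ^+ 2 = 1 by exact: cos2Dsin2.
have vp : ip v (val psi) = 0 by rewrite ipC pv rmorph0.
(* The circle is horizontal throughout, so its Fubini-Study speed is the full norm of its
   velocity. *)
have cc' : ip (val (gc t)) (gc' t) = 0.
  transitivity (C * - (th * S) + S * (th * C) * hnorm v ^+ 2)%:C%C.
    rewrite /= /circle /gc' -/C -/S ipDl !ipDr !ipZl !ipZr pv vp !ipuu hnorm_sphere.
    rewrite !conj_realC expr1n !mulr0 addr0 add0r mulr1.
    by rewrite -!rmorphM -rmorphD/=; apply: (congr1 (real_complex R)); ring.
  case: v1 => ->; first by rewrite !(mul0r, mulr0, oppr0, addr0).
  by rewrite expr1n mulr1; apply: (congr1 (real_complex R)); ring.
rewrite /horizontal cc' scale0r subr0.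
apply/eqP; rewrite -(@eqrXn2 _ 2)// ?hnorm_ge0// /gc' -/C -/S.
rewrite sqr_hnormD ripZl ripZr {1}/rip pv/= !mulr0 addr0 !hnormZr hnorm_sphere mulr1.
rewrite !exprMn !real_normK ?num_real//; apply/eqP.
case: v1 => [->|->]; first by rewrite !(expr2, mul0r, oppr0, addr0).
by rewrite expr1n mulr1 sqrrN -[RHS]mulr1 -CS; ring.
Qed.

Lemma great_circle : exists g : R -> CP H, exists q : sphere H,
  [/\ C1_curve g, g 0 = pi2 psi, g 1 = pi2 q,
      val q = (cos th)%:C%C *: val psi + (sin th)%:C%C *: v & FS_length g = th].
Proof.
exists (pi2 \o gc), (gc 1); split=> //.
- by move=> t _; exists gc, gc'.
- congr pi2; apply: val_inj; rewrite /= /circle mul0r cos0 sin0.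
  by rewrite scale1r scale0r addr0.
- by rewrite /= /circle mul1r.
- rewrite /FS_length (_ : FS_speed _ = cst th); last by apply/funext => t; exact: gc_speed.
  have m01 : mu `[(0 : R), 1] = 1%E.
    by rewrite lebesgue_measure_itv/= lte_fin ltr01 oppr0 adde0.
  rewrite Rintegral_cst; last exact: measurable_itv.
  by rewrite -[RHS]mulr1; congr (_ * _); exact: (congr1 fine m01).
Qed.

End GreatCircle.

(** * The distance equals the projective angle *)

Section DistanceFormula.
Context {R : realType} {H : hilbertType R}.

Lemma unit_phase (z : R[i]) : exists2 u : R[i], `|u| = 1 & u * z = `|z|.
Proof.
have [->|z0] := eqVneq z 0; first by exists 1; rewrite ?normr1 ?mulr0 ?normr0.
have nz : `|z| != 0 by rewrite normr_eq0.
exists (`|z|^-1 * z^*).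
  by rewrite normrM normfV normr_id norm_conjC mulVf.
by rewrite -mulrA [_^* * z]mulrC -normCK expr2 mulKf.
Qed.

Lemma FS_distE (x y : CP H) : FS_dist x y = proj_angle x y.
Proof.
have [psi psix] := pi2_surj x; have [phi phiy] := pi2_surj y.
(* Turning phi by the phase u keeps its ray and makes its product with psi the real number cos th,
   as the endpoint of a horizontal great circle from psi requires. *)
have [u u1 uz] := unit_phase (ip (val psi) (val phi)).
set th := proj_angle x y.
have th0 : 0 <= th := proj_angle_ge0 x y.
have thpi := proj_angle_le_pihalf x y.
pose phi' := u *: val phi.
have pphi' : ip (val psi) phi' = (cos th)%:C%C.
  by rewrite ipZr uz Re_normE cos_proj_angle -psix -phiy absipE.
have nphi' : hnorm phi' = 1 by rewrite hnormZ u1 mul1r hnorm_sphere.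
pose w := horizontal (val psi) phi'.
have phi'E : phi' = (cos th)%:C%C *: val psi + w.
  by rewrite /w /horizontal pphi' addrC subrK.
have nw : hnorm w ^+ 2 = sin th ^+ 2.
  rewrite sqr_hnorm_horizontal ?hnorm_sphere// nphi' pphi' sin2cos2 expr1n.
  by rewrite normc_def/= expr0n/= addr0 sqrtr_sqr real_normK ?num_real.
have pw : ip (val psi) w = 0 by rewrite ip_horizontal// hnorm_sphere.
have sth0 : 0 <= sin th by rewrite sin_ge0_pi// th0 proj_angle_lepi.
(* If sin th = 0, the convention 0^-1 = 0 gives v = 0; this is consistent, since |w| = sin th forces
   w = 0 as well. *)
pose v := (sin th)^-1%:C%C *: w.
have pv : ip (val psi) v = 0 by rewrite ipZr pw mulr0.
have wn : hnorm w = sin th.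
  by apply/eqP; rewrite -(@eqrXn2 _ 2)// ?hnorm_ge0// nw.
have vw : (sin th)%:C%C *: v = w.
  have [s0|s0] := eqVneq (sin th) 0.
    by rewrite s0 scale0r; apply/esym/eqP; rewrite -hnorm_eq0 wn s0.
  by rewrite scalerA -rmorphM/= mulfV// scale1r.
have v1 : th = 0 \/ hnorm v = 1.
  have [->|t0] := eqVneq th 0; [by left|right].
  have s0 : 0 < sin th.
    rewrite sin_gt0_pi// lt_def t0 th0/= (le_lt_trans thpi)//.
    by rewrite ltr_pdivrMr// mulr_natr mulr2n ltrDl pi_gt0.
  by rewrite hnormZr ger0_norm ?invr_ge0// wn mulVf// gt_eqF.
have [g [q [Cg g0 g1 qE Lg]]] := great_circle th0 pv v1.
have qy : pi2 q = y.
  by rewrite -phiy; apply/pi2P; exists u; rewrite // qE vw -phi'E.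
apply/eqP; rewrite eq_le; apply/andP; split.
  apply: ge_inf; last by exists g => //; split; rewrite // ?g0 ?g1.
  exists 0 => _ [h [Ch h0 h1] <-].
  exact: le_trans th0 (proj_angle_le_length Ch h0 h1).
apply: lb_le_inf; first by exists th, g => //; split; rewrite // ?g0 ?g1.
by move=> _ [h [Ch h0 h1] <-]; exact: proj_angle_le_length.
Qed.

End DistanceFormula.

(** * The projection theorem for closed subspaces *)

Section OrthogonalProjection.
Context {R : realType} {H : hilbertType R}.
Implicit Types (u v w : H) (V : set H).

Lemma parallelogram u v :
  hnorm (u + v) ^+ 2 + hnorm (u - v) ^+ 2 = 2 * hnorm u ^+ 2 + 2 * hnorm v ^+ 2.
Proof. by rewrite !sqr_hnormD hnormN ripNr; ring. Qed.

(** A minimizing sequence is Cauchy: midpoints stay in V, so the parallelogram law turns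
    near-minimality into closeness. Its limit exists by completeness and lies in V by closedness. *)
Lemma nearest_vector V u : closed_subspace V ->
  exists2 v, V v & forall w, V w -> hnorm (u - v) <= hnorm (u - w).
Proof.
move=> [Vc V0 VL].
pose D := [set hnorm (u - w) ^+ 2 | w in V].
have D0 : D !=set0 by exists (hnorm (u - 0) ^+ 2), 0.
have lD : has_lbound D by exists 0 => _ [w _ <-]; exact: sqr_ge0.
set d := inf D.
have dle w : V w -> d <= hnorm (u - w) ^+ 2 by move=> Vw; apply: ge_inf => //; exists w.
have ex n : exists w, V w /\ hnorm (u - w) ^+ 2 < d + n.+1%:R^-1.
  have : d < d + n.+1%:R^-1 by rewrite ltrDl invr_gt0.
  by move=> /inf_lt -/(_ D0)[_ [w Vw <-] wd]; exists w.
have [s sP] := choice ex.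
have Vs n : V (s n) by case: (sP n).
have half v w : V v -> V w -> V (2^-1 *: (v + w)).
  move=> Vv Vw; rewrite -[X in V X]addr0; apply: (VL) => //.
  by rewrite -[v]scale1r; apply: (VL).
(* The sum of the two residuals is twice the residual of the midpoint, so its square is at least 4 d
   and cancels the two terms 2 d on the other side. *)
have ss n m : hnorm (s n - s m) ^+ 2 <= 2 * n.+1%:R^-1 + 2 * m.+1%:R^-1.
  have := parallelogram (u - s n) (u - s m).
  have -> : (u - s n) - (u - s m) = - (s n - s m).
    by rewrite !opprB addrACA [- s n + _]addrC addrACA subrr add0r addrC.
  have -> : (u - s n) + (u - s m) = (2 : R)%:C%C *: (u - 2^-1 *: (s n + s m)).
    rewrite rmorph_nat scalerBr scalerA mulfV ?pnatr_eq0// scale1r.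
    by rewrite scaler_nat mulr2n opprD addrACA.
  rewrite hnormN hnormZr exprMn real_normK ?num_real//.
  have := dle _ (half _ _ (Vs n) (Vs m)).
  have [_] := sP n; have [_] := sP m; set a := hnorm _ ^+ 2; set b := hnorm _ ^+ 2.
  set c := hnorm (s n - s m) ^+ 2; set e := hnorm _ ^+ 2; set i := _^-1; set j := _^-1.
  lra.
have cs : cvg (s @ \oo).
  apply: cauchy_cvg; apply: cauchy_exP => e e0.
  have eE : e = (complex.Re e)%:C%C by rewrite RRe_real// gtr0_real.
  have r0 : 0 < complex.Re e by rewrite -ltcR -eE.
  set r := complex.Re e in eE r0.
  (* For n >= N the bound is at most 4 / (N + 1), whence the threshold r^2 / 4. *)
  have : \forall n \near \oo, (n.+1%:R^-1 : R) < r ^+ 2 / 4.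
    have r4 : 0 < r ^+ 2 / 4 by rewrite divr_gt0// exprn_gt0.
    exact: (near_infty_natSinv_lt (PosNum r4)).
  move=> [N _ /(_ N (leqnn N))/= Nr]; exists (s N).
  exists N => // n /= Nn; rewrite -ball_normE/= hnormE eE ltcR.
  rewrite -(ltr_pXn2r (_ : 0 < 2)%N) ?nnegrE ?hnorm_ge0 ?(ltW r0)//.
  apply: le_lt_trans (ss N n) _.
  have : (n.+1%:R^-1 : R) <= N.+1%:R^-1 by rewrite lef_pV2 ?posrE// ler_nat.
  move: Nr; set i := N.+1%:R^-1; set j := n.+1%:R^-1 => Nr ji; lra.
have sv := cs; set v := lim (s @ \oo) in sv.
have Vv : V v by apply: (closed_cvg _ Vc _ _ sv); exact: nearW.
exists v => // w Vw.
rewrite -(ler_pXn2r (_ : 0 < 2)%N) ?nnegrE ?hnorm_ge0//.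
apply: le_trans (dle w Vw).
have cl : hnorm (u - s n) ^+ 2 @[n --> \oo] --> hnorm (u - v) ^+ 2.
  have h : hnorm (u - s n) @[n --> \oo] --> hnorm (u - v).
    by apply: cvg_hnorm; apply: cvgB => //; exact: cvg_cst.
  by rewrite expr2; under eq_cvg do rewrite expr2; apply: cvgM.
have cr : d + n.+1%:R^-1 @[n --> \oo] --> d.
  by rewrite -[X in _ --> X]addr0; apply: cvgD; [exact: cvg_cst|exact: cvg_harmonic].
apply: (ler_cvg_to cl cr); apply: nearW => n.
by case: (sP n) => _ /ltW.
Qed.

(** Moving v by the component of u - v along the unit vector w' leaves the residual
    [horizontal w' (u - v)], which is strictly shorter unless that component vanishes. *)
Lemma nearest_vector_orthogonal V u v : closed_subspace V -> V v ->
  (forall w, V w -> hnorm (u - v) <= hnorm (u - w)) ->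
  forall w, V w -> ip w (u - v) = 0.
Proof.
move=> [_ V0 VL] Vv vmin w Vw.
have [->|w0] := eqVneq w 0; first exact: ip0l.
have nw0 : hnorm w != 0 by rewrite hnorm_eq0.
pose w' := (hnorm w)^-1%:C%C *: w.
have w'1 : hnorm w' = 1.
  by rewrite hnormZr ger0_norm ?invr_ge0 ?hnorm_ge0// mulVf.
have wE : w = (hnorm w)%:C%C *: w' by rewrite scalerA -rmorphM/= mulfV// scale1r.
have Vw' : V w' by rewrite -[w']addr0; apply: (VL).
have : V (ip w' (u - v) *: w' + v) by exact: VL.
move=> /vmin; rewrite opprD addrCA addrC -/(horizontal w' (u - v)).
rewrite -(ler_pXn2r (_ : 0 < 2)%N) ?nnegrE ?hnorm_ge0//.
rewrite sqr_hnorm_horizontal// lerBrDr gerDl => h.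
have /eqP : complex.Re `|ip w' (u - v)| ^+ 2 = 0.
  by apply/eqP; rewrite eq_le sqr_ge0 andbT.
rewrite sqrf_eq0 => /eqP z0; rewrite wE ipZl.
by have /eqP := Re_normE (ip w' (u - v)); rewrite z0 normr_eq0 => /eqP ->; rewrite mulr0.
Qed.

(** [choice] yields feet of perpendiculars with no algebraic structure; linearity and idempotence
    come from uniqueness of the foot, [Euniq]. *)
Lemma orthogonal_projection V : closed_subspace V ->
  exists2 E : H -> H, event E & range E = V.
Proof.
move=> cV; have [_ V0 VL] := cV.
have ex u : exists v, V v /\ forall w, V w -> ip w (u - v) = 0.
  have [v Vv vmin] := nearest_vector u cV.
  by exists v; split => //; exact: nearest_vector_orthogonal cV Vv vmin.
have [E EP] := choice ex.
have VE u : V (E u) by case: (EP u).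
have Eo u w : V w -> ip w (u - E u) = 0 by case: (EP u) => _; apply.
have VB u v : V u -> V v -> V (u - v).
  by move=> Vu Vv; rewrite -[u - v]addrC -scaleN1r; exact: VL.
have Euniq u v : V v -> (forall w, V w -> ip w (u - v) = 0) -> E u = v.
  (* E u - v lies in V and is a difference of two vectors orthogonal to V, hence is orthogonal to
     itself. *)
  move=> Vv vo; apply/eqP; rewrite -subr_eq0 -hnorm_eq0 -sqrf_eq0 -ripuu.
  have Vd := VB _ _ (VE u) Vv.
  rewrite {2}(_ : E u - v = (u - v) - (u - E u)); last by rewrite opprB [RHS]addrC subrKA.
  by rewrite /rip ipBr vo// Eo// subrr.
have EV v : V v -> E v = v.
  by move=> Vv; apply: Euniq => // w _; rewrite subrr ip0r.
have Elin : linear E.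
  move=> a u v; apply: Euniq; first exact: VL.
  move=> w Vw; rewrite opprD addrACA -scalerBr ipDZr !Eo// mulr0 addr0//.
have Eb : bounded_operator E.
  split=> //; exists 1 => u; rewrite mul1r.
  rewrite -(ler_pXn2r (_ : 0 < 2)%N) ?nnegrE ?hnorm_ge0//.
  rewrite -[X in _ <= hnorm X ^+ 2](subrK (E u)) sqr_hnormD.
  by rewrite ripC /rip Eo// mulr0 addr0 lerDr sqr_ge0.
have Es u v : ip (E u) v = ip u (E v).
  have -> : ip (E u) v = ip (E u) (E v).
    by rewrite -{1}(subrK (E v) v) ipDr Eo// add0r.
  have -> // : ip u (E v) = ip (E u) (E v).
  by rewrite -{1}(subrK (E u) u) ipDl [X in X + _]ipC Eo// rmorph0 add0r.
exists E; first by split=> //; apply/funext => u /=; exact: EV.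
by apply/seteqP; split=> [_ [u _ <-]//|v Vv]; exists v => //; exact: EV.
Qed.

(** [pinv] returns a true preimage on the image of [event], and the projection theorem puts S
    there. *)
Lemma subspace_eventP (S : set (CP H)) : projective_subspace S ->
  event (subspace_event S) /\ event_subspace (subspace_event S) = S.
Proof.
move=> [V cV SE]; have [E evE rE] := orthogonal_projection cV.
have SI : S \in event_subspace @` event.
  by apply/mem_set; exists E => //; rewrite /event_subspace rE.
split; last by rewrite /subspace_event pinvK.
apply: (@surjpinv_image_sub _ _ _ _ [set S] event_subspace).
  by move=> _ /= ->; exact: set_mem SI.
by exists S.
Qed.

End OrthogonalProjection.

(** * Overlaps of a ray with a projective subspace *)

Section ProjectionOnSubspace.
Context {R : realType} {H : hilbertType R}.
Implicit Types (x y : CP H) (S : set (CP H)) (E : H -> H).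

Lemma absipC x y : absip x y = absip y x.
Proof. by rewrite /absip ipC norm_conjC. Qed.

Lemma eventE E : event E ->
  [/\ linear E, forall u, E (E u) = E u & forall u v, ip (E u) v = ip u (E v)].
Proof.
by move=> [[El _] EE [_ Es]]; split=> // u; rewrite -[in RHS]EE.
Qed.

Lemma eventZ E (a : R[i]) (u : H) : event E -> E (a *: u) = a *: E u.
Proof.
move=> evE; have [El _ _] := eventE evE.
have E0 : E 0 = 0 by have := El (-1) 0 0; rewrite scaler0 add0r scaleN1r addNr.
by rewrite -[a *: u]addr0 El E0 addr0.
Qed.

(** Unit representatives fixed by E are what lets E move across the inner product onto psi. *)
Lemma event_subspaceP E y : event E ->
  event_subspace E y <-> exists2 q : sphere H, E (val q) = val q & pi2 q = y.
Proof.
move=> evE; have [_ EE _] := eventE evE; split=> [[phi [u _ uE] <-]|[q qE <-]].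
  exists (pi1 phi) => //=; rewrite eventZ//; congr (_ *: _).
  by rewrite -uE EE.
have q0 : val q != 0 by rewrite -normr_eq0 (eqP (valP q)) oner_eq0.
exists (exist _ (val q) q0); first by exists (val q).
rewrite /pi3 /=; congr pi2; apply: val_inj => /=.
by rewrite (eqP (valP q)) invr1 scale1r.
Qed.

Section FixedEvent.
Variables (E : H -> H) (evE : event E) (psi : sphere H).

Lemma ler_absip_event y : event_subspace E y ->
  absip (pi2 psi) y <= hnorm (E (val psi)).
Proof.
have [_ _ Es] := eventE evE.
move=> /(event_subspaceP _ evE)[q qE <-]; rewrite absipC absipE -qE Es.
by rewrite cauchy_schwarz_unit// hnorm_sphere.
Qed.

Lemma absip_event_eq y (nz : E (val psi) != 0) : event_subspace E y ->
  absip (pi2 psi) y = hnorm (E (val psi)) -> y = pi3 (exist _ (E (val psi)) nz).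
Proof.
have [_ _ Es] := eventE evE.
move=> /(event_subspaceP _ evE)[q qE <-]; rewrite absipC absipE -qE Es => qpsi.
have e := cauchy_schwarz_eq (hnorm_sphere q) qpsi.
have z0 : ip (val q) (E (val psi)) != 0.
  by apply: contra nz => /eqP z0; rewrite e z0 scale0r.
have q0 : val q != 0 by rewrite -normr_eq0 (eqP (valP q)) oner_eq0.
transitivity (pi3 (exist _ (val q) q0)).
  rewrite /pi3 /=; congr pi2; apply: val_inj => /=.
  by rewrite (eqP (valP q)) invr1 scale1r.
by apply/esym/pi3P; exists (ip (val q) (E (val psi))).
Qed.

Lemma event_subspace_projection (nz : E (val psi) != 0) :
  event_subspace E (pi3 (exist _ (E (val psi)) nz)).
Proof. by exists (exist _ (E (val psi)) nz) => //=; exists (val psi). Qed.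

(** <psi, E psi> = <E psi, E psi> = |E psi|^2, and normalizing the second entry divides by |E psi|:
    the upper bound on overlaps is attained. *)
Lemma absip_projection (nz : E (val psi) != 0) :
  absip (pi2 psi) (pi3 (exist _ (E (val psi)) nz)) = hnorm (E (val psi)).
Proof.
have [_ EE Es] := eventE evE.
have EEpsi : ip (val psi) (E (val psi)) = `|E (val psi)| ^+ 2.
  by rewrite -ip_norm Es EE.
have := absipE psi (pi1 (exist _ (E (val psi)) nz)).
rewrite [val (pi1 _)]/= ipZr EEpsi expr2 mulKf ?normr_eq0// normr_id; exact.
Qed.

(** If E psi != 0, its ray is a point of the subspace with positive overlap |E psi|; if E psi = 0,
    the upper bound |E psi| kills every overlap. *)
Lemma orthoc_event : orthoc (event_subspace E) (pi2 psi) <-> E (val psi) = 0.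
Proof.
split=> [oS|e0 y /ler_absip_event].
  apply/eqP/negP => /negP nz; have := oS _ (event_subspace_projection nz).
  by rewrite /perp absipC absip_projection => /eqP; rewrite hnorm_eq0; apply/negP.
rewrite e0 hnorm0 /perp absipC => y0.
by apply/eqP; rewrite eq_le y0 absip_ge0.
Qed.

End FixedEvent.

Lemma FS_dist_set_min x y S : S y ->
  (forall z, S z -> FS_dist x y <= FS_dist x z) -> FS_dist_set x S = FS_dist x y.
Proof.
move=> Sy ymin; apply/eqP; rewrite eq_le; apply/andP; split.
  apply: ge_inf; last by exists y.
  by exists (FS_dist x y) => _ [z Sz <-]; exact: ymin.
by apply: lb_le_inf; [exists (FS_dist x y), y|move=> _ [z Sz <-]; exact: ymin].
Qed.

Lemma has_proj_dim0P S : projective_subspace S ->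
  has_proj_dim S 0 <-> exists y, S = [set y].
Proof.
move=> [V cV SV]; split.
  move=> [W [n [_ -> [b bi WE] n1]]].
  have {n1} n1 : n = 1%N by case: n {b bi WE} n1 => [|[|n]].
  subst n; have WP u : W u <-> exists a, u = a *: b ord0.
    rewrite WE; split=> [[a ->]|[a ->]]; first by exists (a ord0); rewrite big_ord1.
    by exists (fun=> a); rewrite big_ord1.
  have b0 : b ord0 != 0.
    apply/eqP => b0; have s0 : \sum_i (1 : R[i]) *: b i = 0.
      by rewrite big_ord1 b0 scaler0.
    by have /eqP := bi (fun=> 1) s0 ord0; rewrite oner_eq0.
  exists (pi3 (exist _ (b ord0) b0)); apply/seteqP; split=> [y [phi /WP[a phiE] <-]|y ->].
    apply/pi3P; exists a => //=; apply: contra (valP phi) => /eqP a0.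
    by rewrite phiE a0 scale0r.
  by exists (exist _ (b ord0) b0) => //=; apply/WP; exists 1; rewrite scale1r.
move=> [y Sy]; have [_ V0 VL] := cV.
have : S y by rewrite Sy.
rewrite SV => -[phi Vphi phiy].
exists V, 1%N; split=> //; exists (fun=> val phi).
  move=> a; rewrite big_ord1 => /eqP; rewrite scaler_eq0 (negbTE (valP phi)) orbF => /eqP a0 i.
  by rewrite ord1.
apply/seteqP; split=> [v Vv|_ [a ->]].
  have [->|v0] := eqVneq v 0; first by exists (fun=> 0); rewrite big_ord1 scale0r.
  (* The ray of a nonzero v in V is a point of S, hence the only one, so v is a multiple of phi. *)
  have : S (pi3 (exist _ v v0)) by rewrite SV; exists (exist _ v v0).
  rewrite Sy /= -phiy => /pi3P[z _ /= ->].
  by exists (fun=> z); rewrite big_ord1.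
by rewrite big_ord1 -[X in V X]addr0; exact: VL.
Qed.

End ProjectionOnSubspace.

(** * Nearest points of a projective subspace *)

Theorem theorem3p1 (R : realType) (H : hilbertType R)
    (dimH : exists b : 'I_2 -> H, lin_indep b)
    (S : set (CP H)) (S0 : S !=set0) (projS : projective_subspace S)
    (x : CP H) :
  (exists y, nearest x S y /\ FS_dist_set x S = proj_angle x y) /\
  ((~ orthoc S x /\
    exists y, [/\ nearest x S y,
      forall y', nearest x S y' -> y' = y,
      forall psi : sphere H, pi2 psi = x ->
        exists nz : subspace_event S (val psi) != 0,
          y = pi3 (exist _ (subspace_event S (val psi)) nz) &
      0 <= FS_dist x y < pi / 2])
   \/
   (orthoc S x /\
    [/\ forall y, S y -> FS_dist_set x S = FS_dist x y /\ FS_dist x y = pi / 2,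
      (exists! y, nearest x S y) <-> has_proj_dim S 0 &
      has_proj_dim S 0 <-> exists y, S = [set y]])).
Proof.
have [evE SE] := subspace_eventP projS.
set E := subspace_event S in evE SE *.
have dim0 := has_proj_dim0P projS.
have angle_near y : nearest x S y -> FS_dist_set x S = proj_angle x y.
  by move=> [_ ->]; exact: FS_distE.
have [psi psix] := pi2_surj x.
have orthoP : orthoc S x <-> E (val psi) = 0.
  by rewrite -{1}SE -psix; exact: orthoc_event.
have [e0|nz] := eqVneq (E (val psi)) 0.
  have ox : orthoc S x by apply/orthoP.
  have dS y : S y -> FS_dist x y = pi / 2.
    by move=> Sy; rewrite FS_distE /proj_angle absipC (ox y Sy) acos0.
  have dxS y : S y -> FS_dist_set x S = FS_dist x y.
    by move=> Sy; apply: FS_dist_set_min => // z Sz; rewrite !dS.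
  have nearS y : nearest x S y <-> S y.
    by split=> [[]//|Sy]; split=> //; exact: dxS.
  split; first by have [y Sy] := S0; exists y; have /nearS ny := Sy; split=> //; exact: angle_near.
  right; split=> //; split=> //; first by move=> y Sy; split; [exact: dxS|exact: dS].
  (* Every point of S is nearest here, so a unique nearest point means that S is a singleton. *)
  rewrite dim0; split=> [[y [/nearS Sy yu]]|[y Sy]]; exists y.
    by apply/seteqP; split=> [z Sz|_ ->//]; apply/esym/yu/nearS.
  by split=> [|z /nearS]; [apply/nearS; rewrite Sy|rewrite Sy => ->].
set y := pi3 (exist _ (E (val psi)) nz).
have Sy : S y by rewrite -SE; exact: event_subspace_projection.
have xy : absip x y = hnorm (E (val psi)) by rewrite -psix absip_projection.
have ny : nearest x S y.
  split=> //; apply: FS_dist_set_min => // z; rewrite -SE => Sz.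
  by rewrite !FS_distE ler_proj_angle xy -psix ler_absip_event.
split; first by exists y; split=> //; exact: angle_near.
left; split; first by move=> /orthoP/eqP; exact/negP.
exists y; split=> //.
(* Equal distances are equal angles, hence equal overlaps, so z attains the bound |E psi| and the
   equality case identifies it. *)
- move=> z [Sz dz]; apply: absip_event_eq => //; first by rewrite SE.
  rewrite psix -xy; apply: proj_angle_inj.
  by rewrite -!FS_distE -dz; case: ny.
(* Another representative phi is a phase times psi, and E carries the phase along without changing
   the ray. *)
- move=> phi; rewrite -psix => /pi2P[z z1 phiE].
  have z0 : z != 0 by rewrite -normr_eq0 z1 oner_eq0.
  have EphiE : E (val phi) = z *: E (val psi) by rewrite phiE eventZ.
  have nz' : E (val phi) != 0 by rewrite EphiE scaler_eq0 negb_or z0.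
  by exists nz'; apply/esym/pi3P; exists z.
- rewrite FS_distE proj_angle_ge0/= lt_neqAle proj_angle_le_pihalf andbT.
  apply/eqP => /(congr1 cos); rewrite cos_proj_angle cos_pihalf xy => /eqP.
  by rewrite hnorm_eq0; exact/negP.
Qed.
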